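(* Let $\Lambda$, $m$ and $s$ be integers, $m$ positive, such that $s\equiv m\pmod{\Lambda}$, and let $\mathcal{B}$ be the set of positive integers $b$ such that $b\mid\Lambda$ if $b$ is odd, or $2b\mid\Lambda$ if $b$ is even. Then the vertices of the parabolas associated (for the modulus $m$) to irreducible fractions $a/b$ with $b\in\mathcal{B}$ are, in the normalized coordinates $X=x/m$, $Y=y/m$ (with $y$ taken modulo $m$, so $Y$ is taken modulo $1$), rational points of the bundle of lines $$Y\equiv 2nX-sX^2\pmod 1,\qquad n=0,\pm1,\pm2,\dots$$ That is, for every irreducible fraction $a/b$ with $b\in\mathcal{B}$ and every parabola $P_i$ associated to $a/b$, with vertex $(x_v,y_v)$, the point $(X_v,Y_v)=(x_v/m,\,y_v/m)$ is rational and there is an integer $n$ with $Y_v\equiv 2nX_v-sX_v^2\pmod 1$.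
   Context: Two rationals $u,v$ are congruent modulo an integer $m$ when $(u-v)/m$ is an integer. Plots of quadratic residues modulo $m$ use coordinates $X=x/m$ and $Y=(x^2 \bmod m)/m$. Parabolas associated to an irreducible fraction $a/b$ ($a\in\mathbb{Z}$, $b$ a positive integer, $\gcd(a,b)=1$) for the modulus $m$: let $x_0=\lfloor\frac{a}{b}m+\frac12\rfloor$, $\alpha=am-bx_0$ (so $\alpha\equiv am\pmod b$, $|\alpha|\le b/2$), $b'=b$ and $c=1$ if $b$ is odd, $b'=b/2$ and $c=2$ if $b$ is even. For each integer $i$ with $|i|\le b'/2$ let $r_i\in\{0,\dots,m-1\}$ with $r_i\equiv(x_0+i)^2\pmod m$, and let $$P_i(j)={b'}^2j^2+2\left(b'i-\frac{\alpha}{c}\right)j+r_i .$$ For integers $j$, $x=x_0+i+jb'$ satisfies $x^2\equiv P_i(j)\pmod m$. The parabola is the curve $x=x_0+i+jb'$, $y=P_i(j)$ (with $y$ considered modulo $m$). Its vertex is the point $(x_v,y_v)$ with $x_v=x_0+i+j_vb'$ and $y_v=P_i(j_v)$, where $j_v\in\mathbb{Q}$ is the value at which the derivative of $P_i$ with respect to $j$ vanishes. *)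

(* Defs.v *)
From mathcomp Require Import all_boot all_order all_algebra.
Set Implicit Arguments.
Unset Strict Implicit.
Unset Printing Implicit Defensive.
Import Order.TTheory GRing.Theory Num.Theory.
Local Open Scope ring_scope.

Definition congr_rat (k : int) (u v : rat) : Prop :=
  (u - v) / k%:~R \is a Num.int.

Section Parabolas.
Variables (m a : int) (b : nat).

Definition par_x0 : int :=
  Num.floor (a%:~R / b%:R * m%:~R + 1 / 2 : rat).

Definition par_alpha : int := a * m - b%:Z * par_x0.

Definition par_b' : nat := if odd b then b else b./2.

Definition par_c : nat := if odd b then 1%N else 2%N.

(* The parabolas attached to a/b are those with index i satisfying
   |i| <= b'/2. *)
Definition par_index (i : int) : bool := `|i|%:~R <= par_b'%:R / 2 :> rat.

(* For m > 0, modz returns the representative in {0, ..., m - 1}. *)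
Definition par_r (i : int) : int := ((par_x0 + i) ^+ 2 %% m)%Z.

Variable R : realFieldType.

Definition par_y (i : int) : {poly R} :=
  (par_b'%:R ^+ 2)%:P * 'X^2
  + (2 * (par_b'%:R * i%:~R - par_alpha%:~R / par_c%:R))%:P * 'X
  + ((par_r i)%:~R)%:P.

Definition par_x (i : int) : {poly R} :=
  ((par_x0 + i)%:~R)%:P + 'X * (par_b'%:R)%:P.

(* The y-coordinate is the representative P_i(j_v) of a class modulo m. *)
Definition is_vertex (i : int) (xv yv : R) : Prop :=
  exists2 jv : R, root (par_y i)^`() jv
    & xv = (par_x i).[jv] /\ yv = (par_y i).[jv].

(* is_vertex does define a single point. *)
Lemma is_vertex_exists_unique (i : int) : (0 < b)%N ->
  exists! p : R * R, is_vertex i p.1 p.2.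
Proof.
move=> b_gt0; set B : R := par_b'%:R.
have B_neq0 : B != 0.
  rewrite pnatr_eq0 -lt0n /par_b'; case: ifP => // ob.
  by case: b b_gt0 ob => [|[|n]].
pose e : R := 2 * (B * i%:~R - par_alpha%:~R / par_c%:R).
have D2 : B ^+ 2 *+ 2 != 0 by rewrite mulrn_eq0 expf_neq0.
have rootE j : root (par_y i)^`() j = (j == - e / (B ^+ 2 *+ 2)).
  rewrite /root /par_y !derivE !hornerE /= -/B -/e.
  rewrite -[RHS](inj_eq (mulIf D2)) divfK // -addr_eq0.
  by rewrite mulrC -mulr2n mulrnAl mulrnAr.
exists ((par_x i).[- e / (B ^+ 2 *+ 2)], (par_y i).[- e / (B ^+ 2 *+ 2)]).
split; first by exists (- e / (B ^+ 2 *+ 2)); rewrite ?rootE.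
by case=> x y [j]; rewrite rootE => /eqP -> [/= -> ->].
Qed.

End Parabolas.

Definition in_B (Lambda : int) (b : nat) : bool :=
  (0 < b)%N &&
  (if odd b then (b%:Z %| Lambda)%Z else ((2 * b)%N%:Z %| Lambda)%Z).

Definition on_bundle (s : int) (X Y : rat) : Prop :=
  exists n : int, congr_rat 1 Y (2 * n%:~R * X - s%:~R * X ^+ 2).

(* Main.v *)
Require Import Defs.
From mathcomp Require Import all_boot all_order all_algebra.
From mathcomp Require Import ring.
Import Order.TTheory GRing.Theory Num.Theory.
Local Open Scope ring_scope.

(** Completing the square in [P_i] gives [x_v = a m / b], and
    [y_v = 2 (x_0 + i) x_v - x_v ^ 2 - q m] with [q] the quotient of
    [(x_0 + i) ^ 2] by [m].  Thus [X_v = a / b] and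
    [Y_v = 2 (x_0 + i) X_v - m X_v ^ 2 - q].  The condition defining [B] says
    that [s - m = b (2 t + b z)] for integers [t] and [z], so modulo 1 replacing
    [m] by [s] costs [2 t a X_v], and [n = x_0 + i + t a] works. *)

Lemma in_B_decomp (Lambda : int) (b : nat) (d : int) :
  in_B Lambda b -> (Lambda %| d)%Z ->
  exists t z : int, d = b%:Z * (2 * t + b%:Z * z).
Proof.
rewrite /in_B => /andP[_]; case: ifP => ob bL Ld.
  have /dvdzP[k ->] := dvdz_trans bL Ld.
  have bE : b%:Z = 1 + 2 * (b./2)%:Z.
    by rewrite -[in LHS](odd_double_half b) ob -mul2n PoszD PoszM.
  (* Here [1 + b./2] is (b + 1)/2, the inverse of 2 modulo the odd [b], and k = 2 k (b + 1)/2 - k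
     b. *)
  by exists (k * (1 + (b./2)%:Z)), (- k); rewrite bE; ring.
have /dvdzP[k ->] := dvdz_trans bL Ld.
by exists k, 0; rewrite PoszM; ring.
Qed.

Lemma par_b'_c (b : nat) : b = (par_b' b * par_c b)%N.
Proof.
rewrite /par_b' /par_c; case: ifP => ob; first by rewrite muln1.
by rewrite muln2 -[in LHS](odd_double_half b) ob.
Qed.

(** Since b = b' c, P_i(j) = (b' j + i - alpha/b)^2 + r_i - (i - alpha/b)^2, and x_0 + alpha/b = a m
    / b. *)
Lemma is_vertexE (R : realFieldType) (m a : int) (b : nat) (i : int)
    (xv yv : R) : (0 < b)%N -> is_vertex m a b i xv yv ->
  xv = a%:~R * m%:~R / b%:R /\
  yv = (par_r m a b i)%:~R - ((par_x0 m a b + i)%:~R - xv) ^+ 2.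
Proof.
move=> b_gt0 [j rj [-> ->]]; move: rj.
have := b_gt0; rewrite {1}(par_b'_c b) muln_gt0 => /andP[b'_gt0 c_gt0].
have B0 : (par_b' b)%:R != 0 :> R by rewrite pnatr_eq0 -lt0n.
have C0 : (par_c b)%:R != 0 :> R by rewrite pnatr_eq0 -lt0n.
have bE : b%:R = (par_b' b)%:R * (par_c b)%:R :> R.
  by rewrite -natrM -par_b'_c.
have alphaE : (par_alpha m a b)%:~R =
    a%:~R * m%:~R - (par_b' b)%:R * (par_c b)%:R * (par_x0 m a b)%:~R :> R.
  by rewrite /par_alpha rmorphB !rmorphM /= -pmulrn bE.
rewrite /root /par_y /par_x !derivE !hornerE /= alphaE bE rmorphD /=.
move: B0 C0; set B := (par_b' b)%:R; set C := (par_c b)%:R => B0 C0 /eqP rj.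
have jE : j = (a%:~R * m%:~R / (B * C) - (par_x0 m a b)%:~R - i%:~R) / B.
  have two0 : (2 : R) != 0 by rewrite pnatr_eq0.
  (* Scaling by the leading coefficient [2 * B ^+ 2] of the derivative turns the difference of the
     two sides into its value at [j], which is 0 by [rj]. *)
  apply: (mulfI (mulf_neq0 two0 (expf_neq0 2 B0))).
  apply/eqP; rewrite -subr_eq0 -rj; apply/eqP.
  by field; rewrite B0 C0.
by rewrite jE; split; field; rewrite B0 C0.
Qed.

Theorem proposition3 (R : realFieldType) (Lambda m s : int)
    (m_gt0 : 0 < m) (s_m : (s = m %[mod Lambda])%Z)
    (a : int) (b : nat) (b_in : in_B Lambda b) (ab : coprimez a b%:Z)
    (i : int) (i_idx : par_index b i)
    (xv yv : R) (vtx : is_vertex m a b i xv yv) :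
  exists X Y : rat,
    [/\ xv / m%:~R = ratr X, yv / m%:~R = ratr Y & on_bundle s X Y].
Proof.
have b_gt0 : (0 < b)%N by case/andP: b_in.
have [xvE yvE] := is_vertexE _ _ _ _ _ _ _ b_gt0 vtx.
have [t [z smE]] : exists t z : int, s - m = b%:Z * (2 * t + b%:Z * z).
  apply: in_B_decomp b_in _.
  by rewrite -eqz_mod_dvd; apply/eqP.
set x1 := par_x0 m a b + i in yvE.
pose q := (x1 ^+ 2 %/ m)%Z.
have rE : par_r m a b i = x1 ^+ 2 - q * m.
  by rewrite /par_r -/x1 [in RHS](divz_eq (x1 ^+ 2) m) addrAC subrr add0r.
have m0 (F : numFieldType) : m%:~R != 0 :> F by rewrite intr_eq0 gt_eqF.
have b0 (F : numFieldType) : b%:R != 0 :> F by rewrite pnatr_eq0 -lt0n.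
(* [X] is made opaque so that the morphism rewrites keep [ratr X] whole for [ratX]. *)
have [X XE] : exists X : rat, X = a%:~R / b%:R by eexists.
have ratX : ratr X = a%:~R / b%:R :> R.
  by rewrite XE fmorph_div /= ratr_int ratr_nat.
exists X, (2 * x1%:~R * X - m%:~R * X ^+ 2 - q%:~R); split.
- by rewrite xvE ratX; field; rewrite m0 b0.
- rewrite !(rmorphXn, rmorphB, rmorphM) /= ratX !ratr_int ratr_nat yvE rE xvE.
  rewrite !(rmorphXn, rmorphB, rmorphM) /=.
  by field; rewrite m0 b0.
exists (x1 + t * a); rewrite /congr_rat divr1.
have -> : s = m + b%:Z * (2 * t + b%:Z * z) by rewrite -smE addrC subrK.
(* As X = a/b, (s - m) X^2 = 2 t a X + z a^2; the shift [t * a] in [n] cancels the first term and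
   leaves this integer. *)
rewrite [X in X \is a _](_ : _ = (z * a ^+ 2 - q)%:~R) ?intr_int //.
rewrite XE !(rmorphB, rmorphD, rmorphM, rmorphXn) /= -!pmulrn.
by field; rewrite b0.
Qed.
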